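(* Let $G$ be a nontrivial connected graph. Then $\mathrm{scfc}(G)=1$ if and only if $G$ is a complete graph.
   Context: All graphs are finite, simple and undirected; nontrivial means having at least two vertices. Edge-colorings are arbitrary (adjacent edges may receive the same color). A path in an edge-colored graph is conflict-free if some color is used on exactly one of its edges. An edge-colored graph $G$ is strongly conflict-free connected if for every pair of distinct vertices $u,v$ there is a conflict-free path of length $d_G(u,v)$ connecting them. For a connected graph $G$, $\mathrm{scfc}(G)$ is the smallest number of colors in an edge-coloring making $G$ strongly conflict-free connected. *)

(* Defs.v *)
From mathcomp Require Import all_boot.

Set Implicit Arguments.
Unset Strict Implicit.
Unset Printing Implicit Defensive.

Record sgraph := SGraph {
  vertex :> finType;
  adj : rel vertex;
  adj_sym : symmetric adj;
  adj_irr : irreflexive adj }.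

Arguments adj {s} _ _.

Section Graph.

Variable G : sgraph.
Implicit Types (u v : G) (p : seq G).

Definition edges : {set {set G}} :=
  [set f | [exists x : G, exists y : G, adj x y && (f == [set x; y])]].

Definition edge := {f : {set G} | f \in edges}.

Definition connected : bool := [forall u : G, forall v : G, connect adj u v].

Definition complete : bool :=
  [forall u : G, forall v : G, (u != v) ==> adj u v].

(* The vertices of the path are [u :: p], so its length is [size p]. *)
Definition is_path u v p : bool :=
  [&& path adj u p, last u p == v & uniq (u :: p)].

(* Least length of a path from [u] to [v]; the value is [#|G|] when there is no
   such path. *)
Definition dist u v : nat :=
  find (fun n => [exists p : n.-tuple G, is_path u v p]) (iota 0 #|G|).

(* [pmap insub] discards pairs that are not edges; nothing is discarded when
   [u :: p] is a path. *)
Definition path_edges u p : seq edge :=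
  pmap insub (pairmap (fun x y => [set x; y]) u p).

Definition coloring k := {ffun edge -> 'I_k}.

Definition conflict_free k (c : coloring k) u p : bool :=
  [exists a : 'I_k, count (fun f => c f == a) (path_edges u p) == 1].

Definition strongly_cf_connected k (c : coloring k) : bool :=
  [forall u : G, forall v : G, (u != v) ==>
    [exists p : (dist u v).-tuple G, is_path u v p && conflict_free c u p]].

Definition scf_colorable k : bool :=
  [exists c : coloring k, strongly_cf_connected c].

Lemma dist_path u v :
  connect adj u v -> exists p : (dist u v).-tuple G, is_path u v p.
Proof.
move=> /connectP[q eq_q ->{v}]; case/shortenP: eq_q => p p_path p_uniq _.
set v := last u p; set P := fun n => [exists p : n.-tuple G, is_path u v p].
have lt_p : size p < #|G| by have /= := max_card (mem (u :: p)); rewrite (card_uniqP p_uniq).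
have hasP : has P (iota 0 #|G|).
  apply/hasP; exists (size p); first by rewrite mem_iota.
  by apply/existsP; exists (in_tuple p); rewrite /is_path p_path p_uniq eqxx.
have := nth_find 0 hasP; rewrite nth_iota; last by move: hasP; rewrite has_find size_iota.
by move=> /existsP[r r_path]; exists r.
Qed.

(* With pairwise distinct colors every path with at least one edge is
   conflict-free. *)
Lemma scf_colorable_exists : connected -> exists k, scf_colorable k.
Proof.
move=> /forallP conn; exists #|{: edge}|; apply/existsP.
exists [ffun f => enum_rank f].
apply/forallP=> u; apply/forallP=> v; apply/implyP=> neq_uv.
have [p p_path] := dist_path (forallP (conn u) v).
apply/existsP; exists p; rewrite p_path /=.
case: (tval p) p_path => [|x q] /and3P[] /=; first by rewrite (negPf neq_uv).
case/andP=> ux _ _ /andP[u_notin _].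
have f_edge : [set u; x] \in edges.
  by rewrite inE; apply/existsP; exists u; apply/existsP; exists x; rewrite ux eqxx.
apply/existsP; exists (enum_rank (Sub [set u; x] f_edge : edge)).
rewrite /path_edges /= insubT /= ffunE eqxx add1n eqSS -leqn0 leqNgt -has_count.
apply/hasPn=> f; rewrite mem_pmap_sub ffunE (inj_eq enum_rank_inj) => f_in.
apply: contra u_notin => /eqP f_eq; move: f_in; rewrite f_eq /=.
have u_in : u \in [set u; x] by rewrite !inE eqxx.
move: [set u; x] u_in => F u_in {f f_eq ux f_edge}.
elim: q x => //= y q IHq x; rewrite inE => /predU1P[F_eq|/IHq].
  by move: u_in; rewrite F_eq !inE => /orP[]->; rewrite ?orbT.
by rewrite !inE => ->; rewrite orbT.
Qed.

Definition scfc (conn : connected) : nat := ex_minn (scf_colorable_exists conn).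

End Graph.

Arguments connected G : clear implicits.
Arguments complete G : clear implicits.

(* Main.v *)
Require Import Defs.
From mathcomp Require Import all_boot.

(** With a single color, every edge of a path has that color, so the color is
    used exactly once precisely when the path has one edge: the conflict-free
    paths are the paths of length one ([conflict_free1]).  A one-coloring that
    makes the graph strongly conflict-free connected therefore joins any two
    distinct vertices by an edge; conversely, in a complete graph distinct
    vertices are at distance one, and the edge between them is a conflict-free
    shortest path ([scf_colorable1]).  Finally, two distinct vertices already
    rule out an empty set of colors ([scf_colorable0]), so the least number of
    colors is one as soon as one color suffices. *)

(** This is what makes counting in [path_edges] faithful: consecutive vertices
    of a walk are adjacent, so [insub] never discards a pair. *)
Lemma size_path_edges (G : sgraph) (u : G) (p : seq G) :
  path adj u p -> size (path_edges u p) = size p.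
Proof.
rewrite /path_edges; elim: p u => //= x p IHp u /andP[ux /IHp IH].
have ux_edge : [set u; x] \in edges G.
  by rewrite inE; apply/existsP; exists u; apply/existsP; exists x;
     rewrite ux eqxx.
by rewrite insubT /= IH.
Qed.

Lemma conflict_free1 (G : sgraph) (c : coloring G 1) (u : G) (p : seq G) :
  path adj u p -> conflict_free c u p = (size p == 1).
Proof.
move=> up; have count_all a :
    count (fun f => c f == a) (path_edges u p) = size p.
  rewrite -(size_path_edges _ _ _ up); apply/eqP; rewrite -all_count.
  by apply/allP=> f _; rewrite [c f]ord1 [a]ord1.
by apply/existsP/idP=> [[a]|size_p]; last exists ord0; rewrite count_all.
Qed.

(** A path has distinct vertices, so its length is below [#|G|] and thus lies
    in the range searched by [dist]. *)
Lemma dist_le (G : sgraph) (u v : G) (p : seq G) :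
  is_path u v p -> dist u v <= size p.
Proof.
move=> p_path; case/and3P: (p_path) => _ _ p_uniq.
have lt_p : size p < #|G|.
  by have /= := max_card (mem (u :: p)); rewrite (card_uniqP p_uniq).
rewrite leqNgt; apply/negP=> /(before_find 0).
rewrite nth_iota // add0n => /negbT/existsP[].
by exists (in_tuple p).
Qed.

Lemma adj_dist (G : sgraph) (u v : G) : adj u v -> dist u v = 1.
Proof.
move=> uv; have neq_uv : u != v.
  by apply: contraTneq uv => ->; rewrite adj_irr.
have dist_le1 : dist u v <= 1.
  by apply: (dist_le _ _ _ [:: v]); rewrite /is_path /= uv eqxx inE neq_uv.
have [p] := dist_path (connect1 uv); move: (size_tuple p).
case: (tval p) => [_ /and3P[_]|x q size_p _]; first by rewrite /= (negPf neq_uv).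
by apply/eqP; rewrite eqn_leq dist_le1 -size_p.
Qed.

Lemma scf_colorable0 (G : sgraph) : 1 < #|G| -> ~~ scf_colorable G 0.
Proof.
case/card_gt1P=> u [v [_ _ neq_uv]]; apply/negP=> /existsP[c].
move=> /forallP/(_ u)/forallP/(_ v)/implyP/(_ neq_uv)/existsP[p].
by case/andP=> _ /existsP[[]].
Qed.

Lemma scf_colorable1 (G : sgraph) : scf_colorable G 1 = complete G.
Proof.
apply/existsP/idP=> [[c scf]|G_complete].
  apply/forallP=> u; apply/forallP=> v; apply/implyP=> neq_uv.
  move: scf => /forallP/(_ u)/forallP/(_ v)/implyP/(_ neq_uv)/existsP[p].
  case/andP=> /and3P[up /eqP last_p _]; rewrite conflict_free1 //.
  by case: (tval p) up last_p => [|x [|y q]] //= /andP[ux _] <-.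
exists [ffun=> ord0]; apply/forallP=> u; apply/forallP=> v.
apply/implyP=> neq_uv.
have uv : adj u v by move: G_complete => /forallP/(_ u)/forallP/(_ v)/implyP; apply.
have [p p_path] := dist_path (connect1 uv).
apply/existsP; exists p; rewrite p_path conflict_free1; last by case/and3P: p_path.
by rewrite size_tuple adj_dist.
Qed.

Theorem theorem4p1 (G : sgraph) (nontrivial : 1 < #|G|) (conn : connected G) :
  scfc conn = 1 <-> complete G.
Proof.
rewrite -scf_colorable1 /scfc; case: ex_minnP => k k_col k_min.
split=> [<- //|/k_min].
by case: k k_col {k_min} => [|[|k]] //; rewrite (negPf (scf_colorable0 G nontrivial)).
Qed.
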